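(* Let $A=(W,(\cdot|\cdot),\wedge)$ be a real noncommutative Jordan linear division algebra of dimension $8$. Let $B$ be a subalgebra of $A$ of dimension $4$ such that $B^{\perp}B^{\perp}\subseteq B$. Then there exists $(u_0,x_0)\in B\times B^{\perp}$ such that $u_0$ and $x_0$ generate a subalgebra of $A$ of dimension $4$.
   Context: An algebra is a vector space with a bilinear product (not assumed associative or unital). $(x,y,z)=(xy)z-x(yz)$. An algebra is noncommutative Jordan if $(x,y,x)=0$ and $(x^2,y,x)=0$ for all $x,y$. An algebra $A\ne\{0\}$ is a linear division algebra if for every nonzero $x$ the maps $y\mapsto xy$ and $y\mapsto yx$ are bijective. A finite-dimensional real noncommutative Jordan linear division algebra is unital and quadratic, so it can be written $A=\mathbb{R}1\oplus W$ with product $(\alpha+x)(\beta+y)=(\alpha\beta+(x|y))+(\alpha y+\beta x+x\wedge y)$ for $\alpha,\beta\in\mathbb{R}$, $x,y\in W$, where $\wedge$ is an anticommutative bilinear product on $W$ and $(\cdot|\cdot)$ is a symmetric negative definite bilinear form on $W$; this is what the notation $A=(W,(\cdot|\cdot),\wedge)$ means. The form is extended to $A$ by $(\alpha+x|\beta+y)=\alpha\beta+(x|y)$, and $B^{\perp}$ is the orthogonal of $B$ in $A$ for this extended form. *)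

(* Defs.v *)
From HB Require Import structures.
From mathcomp Require Import all_boot all_order all_algebra.
From mathcomp Require Import sesquilinear.
From mathcomp Require Import reals.

Set Implicit Arguments.
Unset Strict Implicit.
Unset Printing Implicit Defensive.

Import Order.TTheory GRing.Theory Num.Theory.
Local Open Scope ring_scope.

(* A finite-dimensional nonassociative algebra is a pair of a vector space A
   (a vectType) and a bilinear product mul on it. *)

Section Algebra.
Variables (R : realType) (A : vectType R) (mul : {bilinear A -> A -> A}).

Definition associator (x y z : A) : A := mul (mul x y) z - mul x (mul y z).

Definition noncommutative_jordan : Prop :=
  (forall x y, associator x y x = 0) /\
  (forall x y, associator (mul x x) y x = 0).

Definition linear_division : Prop :=
  (exists x : A, x != 0) /\
  (forall x : A, x != 0 ->
     bijective (fun y => mul x y) /\ bijective (fun y => mul y x)).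

Definition is_subalgebra (B : {vspace A}) : Prop :=
  forall x y, x \in B -> y \in B -> mul x y \in B.

Definition generates_subalgebra (X : A -> Prop) (S : {vspace A}) : Prop :=
  [/\ is_subalgebra S,
      forall x, X x -> x \in S
    & forall T : {vspace A},
        is_subalgebra T -> (forall x, X x -> x \in T) -> (S <= T)%VS].

(* The data of A = (W, (.|.), /\): a decomposition A = R 1 (+) W together with
   the form and the anticommutative product on W which determine mul. *)
Record quadratic_decomposition := QuadraticDecomposition {
  qd_one : A;
  qd_W : {vspace A};
  qd_form : {biscalar (subvs_of qd_W)};
  qd_wedge : {bilinear (subvs_of qd_W) -> (subvs_of qd_W) -> (subvs_of qd_W)};
  qd_one_neq0 : qd_one != 0;
  qd_direct : directv (<[qd_one]> + qd_W);
  qd_full : (<[qd_one]> + qd_W)%VS = fullv;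
  qd_form_sym : forall x y, qd_form x y = qd_form y x;
  qd_form_neg : forall x, x != 0 -> qd_form x x < 0;
  qd_wedge_anti : forall x y, qd_wedge x y = - qd_wedge y x;
  qd_mulE : forall (a b : R) (x y : subvs_of qd_W),
    mul (a *: qd_one + vsval x) (b *: qd_one + vsval y) =
      (a * b + qd_form x y) *: qd_one +
      vsval (a *: y + b *: x + qd_wedge x y)
}.

Variable D : quadratic_decomposition.

Definition qd_scal (z : A) : R :=
  coord [tuple qd_one D] ord0 (daddv_pi <[qd_one D]> (qd_W D) z).

Definition qd_vec (z : A) : subvs_of (qd_W D) :=
  vsproj (qd_W D) (daddv_pi (qd_W D) <[qd_one D]> z).

Definition qd_extform (z t : A) : R :=
  qd_scal z * qd_scal t + qd_form D (qd_vec z) (qd_vec t).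

Definition in_orth (B : {vspace A}) (z : A) : Prop :=
  forall b, b \in B -> qd_extform z b = 0.

Let capD : (<[qd_one D]> :&: qd_W D = 0)%VS.
Proof. by apply/directv_addP; exact: qd_direct. Qed.

Lemma qd_scalE (a : R) (x : subvs_of (qd_W D)) :
  qd_scal (a *: qd_one D + vsval x) = a.
Proof.
have one_in := memvZ a (memv_line (qd_one D)).
rewrite /qd_scal linearD /= (daddv_pi_id capD one_in).
have -> : daddv_pi <[qd_one D]> (qd_W D) (vsval x) = 0.
  have := daddv_pi_add capD (subvP (addvSr _ _) _ (subvsP x)).
  rewrite (daddv_pi_id _ (subvsP x)) 1?capvC //.
  by move/(canRL (addrK _)); rewrite subrr.
have free1 : free [tuple qd_one D] by rewrite seq1_free qd_one_neq0.
rewrite addr0 linearZ /=.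
have := coord_free ord0 ord0 free1; rewrite /= => ->.
by rewrite mulr1.
Qed.

Lemma qd_vecE (a : R) (x : subvs_of (qd_W D)) :
  qd_vec (a *: qd_one D + vsval x) = x.
Proof.
have capD' : (qd_W D :&: <[qd_one D]> = 0)%VS by rewrite capvC.
have one_in := memvZ a (memv_line (qd_one D)).
rewrite /qd_vec linearD /= (daddv_pi_id capD' (subvsP x)).
have -> : daddv_pi (qd_W D) <[qd_one D]> (a *: qd_one D) = 0.
  have := daddv_pi_add capD (subvP (addvSl _ _) _ one_in).
  rewrite (daddv_pi_id capD one_in).
  by move/(canRL (addKr _)); rewrite addNr.
by rewrite add0r vsvalK.
Qed.

Lemma qd_extformE (a b : R) (x y : subvs_of (qd_W D)) :
  qd_extform (a *: qd_one D + vsval x) (b *: qd_one D + vsval y) =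
  a * b + qd_form D x y.
Proof. by rewrite /qd_extform !qd_scalE !qd_vecE. Qed.

End Algebra.

(* Main.v *)
(* Write (.|.) for the extended form; flexibility makes it associative,
   (xy|z) = (x|yz), so V = B :&: W maps B^perp into itself.  The ratio
   (ux|ux) / ((u|u)(x|x)) over nonzero u in V and x in B^perp is homogeneous of
   degree 0 in each variable, so by compactness it attains its maximum at some
   (u, x).  Criticality in each variable, together with associativity of the
   form and B^perp B^perp <= B, gives (ux)x = a u and u(ux) = b x for scalars
   a, b.  Hence the span of the orthogonal vectors 1, u, x, ux is a subalgebra;
   it has dimension 4 since ux <> 0. *)

From HB Require Import structures.
Require Import Defs.
From mathcomp Require Import all_boot all_order all_algebra.
From mathcomp Require Import sesquilinear.
From mathcomp Require Import reals.
From mathcomp Require Import boolp classical_sets topology normedtype derive.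
From mathcomp Require Import ring lra.

Import Order.TTheory GRing.Theory Num.Theory numFieldNormedType.Exports.
Local Open Scope ring_scope.

(** * Maximum of a ratio of quadratic forms and its first-order conditions *)

Section Extremal.
Local Open Scope classical_set_scope.
Local Open Scope ring_scope.
Context {R : realType} {A : vectType R}.
Implicit Types (q : {biscalar A}) (mul : {bilinear A -> A -> A}).

Lemma continuous_sum (T : topologicalType) (I : finType) (c : I -> T -> R) :
  (forall i, continuous (c i)) -> continuous (fun t => \sum_i c i t).
Proof.
by move=> cc t; apply: cvg_big => [|i _]; [exact: add_continuous | exact: cc].
Qed.

(** [A] is a bare vector space, so continuity is expressed through real coefficients: by bilinearity
    the value is a polynomial in the [c i t]. *)
Lemma continuous_form_comb (T : topologicalType) q (I : finType)
    (c : I -> T -> R) (w : I -> A) :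
  (forall i, continuous (c i)) ->
  continuous (fun t => q (\sum_i c i t *: w i) (\sum_i c i t *: w i)).
Proof.
move=> cc.
have -> : (fun t => q (\sum_i c i t *: w i) (\sum_i c i t *: w i)) =
          (fun t => \sum_i \sum_j (c i t * c j t) * q (w i) (w j)).
  apply/funext => t; rewrite linear_sumlz; apply: eq_bigr => i _.
  rewrite linear_sumr; apply: eq_bigr => j _.
  by rewrite linearZl_LR /= linearZr_LR /= mulrA.
do 2![apply: continuous_sum => ?]; move=> t.
by apply: cvgM; [apply: cvgM; exact: cc | exact: cvg_cst].
Qed.

(** The Euclidean sphere of coordinates, independent of any form on [A], so that compactness is a
    fact about row vectors. *)
Definition coord_sphere n : set 'rV[R]_n := [set v | \sum_i v 0 i ^+ 2 = 1].

(** It is closed, being a level set of a continuous function, and lies in the compact cube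
    [[-1, 1]^n]. *)
Lemma compact_coord_sphere n : compact (coord_sphere n).
Proof.
have cB := @rV_compact R n (fun=> `[-1, 1]%classic) (fun=> @segment_compact R _ _).
apply: subclosed_compact cB _.
  apply: (@preimage_closed _ _ (fun v : 'rV[R]_n => \sum_i v 0 i ^+ 2) [set 1]).
    move=> v _; apply: continuous_sum => i {}v.
    apply: (@continuousM _ _ (fun v : 'rV[R]_n => v 0 i) (fun v : 'rV[R]_n => v 0 i)).
    1,2: exact: (@coord_continuous R 1 n 0 i).
  exact: closed_eq.
move=> v sv i /=; rewrite in_itv /= -ler_norml -(@ler_sqr _ `|_| 1) ?nnegrE //.
rewrite real_normK ?num_real // expr1n -sv (bigD1 i) //= lerDl.
by apply: sumr_ge0 => j _; exact: sqr_ge0.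
Qed.

Definition vcomb (V : {vspace A}) (v : 'rV[R]_(\dim V)) : A :=
  \sum_i v 0 i *: (vbasis V)`_i.

Lemma vcomb_sphere_neq0 V v : coord_sphere _ v -> vcomb V v != 0.
Proof.
move=> sv; apply/eqP => v0.
have /freeP fV := basis_free (vbasisP V).
move: sv; rewrite /coord_sphere /= big1 => [/eqP|i _].
  by rewrite eq_sym oner_eq0.
by rewrite (fV (fun i => v 0 i) v0) expr0n.
Qed.

Lemma vcomb_in V v : vcomb V v \in V.
Proof.
by apply: rpred_sum => i _; apply: rpredZ; apply: vbasis_mem; apply: mem_nth;
  rewrite size_tuple.
Qed.

(** Divide the coordinates of [u] in [vbasis V] by their Euclidean norm [k]. *)
Lemma vcomb_sphere_onto {V : {vspace A}} {u : A} : u \in V -> u != 0 ->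
  exists (k : R) v, [/\ k != 0, coord_sphere _ v & u = k *: vcomb V v].
Proof.
move=> uV un0; pose c i := coord (vbasis V) i u.
have uE : u = \sum_i c i *: (vbasis V)`_i by exact: coord_vbasis.
pose s := \sum_i c i ^+ 2; pose k := Num.sqrt s.
have s0 : 0 <= s by apply: sumr_ge0 => i _; exact: sqr_ge0.
have sn0 : s != 0.
  apply: contra un0 => s_eq0; rewrite uE big1 // => i _.
  move: s_eq0; rewrite psumr_eq0 => [/allP/(_ i)|j _]; last exact: sqr_ge0.
  by rewrite mem_index_enum sqrf_eq0 => /(_ isT)/eqP ->; rewrite scale0r.
have kn0 : k != 0 by rewrite sqrtr_eq0 -ltNge lt_def sn0.
exists k, (\row_i (c i / k)); split=> //.
  rewrite /coord_sphere /=.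
  under eq_bigr do rewrite mxE expr_div_n.
  by rewrite -mulr_suml sqr_sqrtr // divff.
rewrite /vcomb scaler_sumr {1}uE; apply: eq_bigr => i _.
by rewrite mxE scalerA mulrC divfK.
Qed.

Lemma coord_sphere_neq0 n : (0 < n)%N -> coord_sphere n !=set0.
Proof.
case: n => // n _; exists (delta_mx 0 0).
rewrite /coord_sphere /= (bigD1 ord0) //= big1 ?addr0 => [|i i0].
  by rewrite mxE !eqxx expr1n.
by rewrite mxE (negPf i0) andbF expr0n.
Qed.

Lemma continuous_fst_coord m n i :
  continuous (fun p : 'rV[R]_m * 'rV[R]_n => p.1 0 i).
Proof.
move=> p.
apply: (@continuous_comp _ _ _ (@fst 'rV[R]_m 'rV[R]_n) (fun v => v 0 i)).
  exact: cvg_fst.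
exact: coord_continuous.
Qed.

Lemma continuous_snd_coord m n i :
  continuous (fun p : 'rV[R]_m * 'rV[R]_n => p.2 0 i).
Proof.
move=> p.
apply: (@continuous_comp _ _ _ (@snd 'rV[R]_m 'rV[R]_n) (fun v => v 0 i)).
  exact: cvg_snd.
exact: coord_continuous.
Qed.

(* The ratio is homogeneous of degree 0 in both variables, so its maximum over
   a product of coordinate spheres is a global one. *)
Lemma bilinear_ratio_max q mul (U V : {vspace A}) :
  U != 0%VS -> V != 0%VS ->
  (forall u, u \in U -> u != 0 -> q u u != 0) ->
  (forall x, x \in V -> x != 0 -> q x x != 0) ->
  let rho u x := q (mul u x) (mul u x) / (q u u * q x x) in
  exists u0 x0, [/\ u0 \in U, u0 != 0, x0 \in V, x0 != 0 &
    forall u x, u \in U -> u != 0 -> x \in V -> x != 0 ->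
      rho u x <= rho u0 x0].
Proof.
move=> Un0 Vn0 qU qV rho.
pose S := coord_sphere (\dim U) `*` coord_sphere (\dim V).
have S0 : S !=set0.
  have [|a Sa] := coord_sphere_neq0 (\dim U); first by rewrite lt0n dimv_eq0.
  have [|b Sb] := coord_sphere_neq0 (\dim V); first by rewrite lt0n dimv_eq0.
  by exists (a, b).
have cS : compact S by apply: compact_setX; exact: compact_coord_sphere.
pose f p := rho (vcomb U p.1) (vcomb V p.2).
have cf : {within S, continuous f}.
  set P := ('rV[R]_(\dim U) * 'rV[R]_(\dim V))%type in S S0 cS f *.
  apply: continuous_in_subspaceT => -[a b] /set_mem[/= Sa Sb].
  pose qU' (p : P) := q (vcomb U p.1) (vcomb U p.1).
  pose qV' (p : P) := q (vcomb V p.2) (vcomb V p.2).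
  (* The product expanded over pairs of basis vectors, under one index, to fit
     [continuous_form_comb]. *)
  pose w (p : P) := \sum_(ij : 'I_(\dim U) * 'I_(\dim V))
    (p.1 0 ij.1 * p.2 0 ij.2) *: mul (vbasis U)`_ij.1 (vbasis V)`_ij.2.
  have wE p : mul (vcomb U p.1) (vcomb V p.2) = w p.
    rewrite linear_sumlz /w.
    rewrite -(pair_bigA _ (fun i j => (p.1 0 i * p.2 0 j) *:
      mul (vbasis U)`_i (vbasis V)`_j)) /=; apply: eq_bigr => i _.
    rewrite linear_sumr; apply: eq_bigr => j _.
    by rewrite linearZl_LR /= linearZr_LR /= scalerA.
  have cw : continuous (fun p => q (w p) (w p)).
    apply: continuous_form_comb => -[i j] p.
    exact: continuousM (@continuous_fst_coord _ _ i p)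
                       (@continuous_snd_coord _ _ j p).
  have cU' : continuous qU'.
    by apply: continuous_form_comb => i; exact: continuous_fst_coord.
  have cV' : continuous qV'.
    by apply: continuous_form_comb => i; exact: continuous_snd_coord.
  have -> : f = (fun p => q (w p) (w p)) \* (fun p => (qU' p * qV' p)^-1).
    by apply/funext => p; rewrite /f /rho wE.
  apply: continuousM (cw _) _.
  (* The denominator does not vanish on [S], since sphere points give nonzero vectors. *)
  apply: continuousV; last exact: continuousM (cU' _) (cV' _).
  apply: mulf_neq0; [apply: qU | apply: qV]; do ?exact: vcomb_in;
    exact: vcomb_sphere_neq0.
have [[a b] /set_mem [/= Sa Sb] fmax] := compact_EVT_max S0 cS cf.
exists (vcomb U a), (vcomb V b); split; rewrite ?vcomb_in ?vcomb_sphere_neq0 //.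
move=> u x uU un0 xV xn0.
have [k [c [kn0 Sc ->]]] := vcomb_sphere_onto uU un0.
have [l [d [ln0 Sd ->]]] := vcomb_sphere_onto xV xn0.
have := fmax (c, d) (mem_set (conj Sc Sd)); rewrite /f /=.
(* By homogeneity the factor [k ^+ 2 * l ^+ 2] cancels, so the two ratios are in fact equal. *)
apply: le_trans; rewrite le_eqVlt; apply/orP; left; apply/eqP.
have qZ (r : R) z : q (r *: z) (r *: z) = r ^+ 2 * q z z.
  by rewrite linearZl_LR linearZr_LR /= mulrA.
rewrite /rho.
have -> : mul (k *: vcomb U c) (l *: vcomb V d) =
          (k * l) *: mul (vcomb U c) (vcomb V d).
  by rewrite linearZl_LR linearZr_LR /= scalerA.
rewrite !qZ.
have := qU _ (vcomb_in U c) (vcomb_sphere_neq0 U c Sc).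
have := qV _ (vcomb_in V d) (vcomb_sphere_neq0 V d Sd).
set Q := q (mul _ _) _; set Q1 := q (vcomb U c) _; set Q2 := q (vcomb V d) _.
by move=> *; field; rewrite kn0 ln0; do ?[apply/andP; split].
Qed.

(** The quadratic form [c * q u u - q (L u) (L u)] is nonnegative on [U] and vanishes at [u0], so
    its polar form vanishes there in every direction [h]. No sign of [c] or of [q] is assumed. *)
Lemma critical_point_linear q (L : {linear A -> A}) (U : {vspace A}) c u0 :
  (forall x y, q x y = q y x) -> u0 \in U ->
  (forall u, u \in U -> q (L u) (L u) <= c * q u u) ->
  q (L u0) (L u0) = c * q u0 u0 ->
  forall h, h \in U -> q (L u0) (L h) = c * q u0 h.
Proof.
move=> qC u0U qle qeq h hU.
pose b := c * q u0 h - q (L u0) (L h).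
pose e := c * q h h - q (L h) (L h).
have qE x y t : q (x + t *: y) (x + t *: y) =
    q x x + 2 * t * q x y + t ^+ 2 * q y y.
  have qZ u v : q u (t *: v) = t * q u v by rewrite linearZr_LR.
  by rewrite linearDl !linearDr /= (qC (t *: y) x) !qZ (qC (t *: y) y) qZ; ring.
(* The nonnegative form evaluated at [u0 + t *: h]; its constant term is zero by [qeq]. *)
have quad t : 0 <= 2 * b * t + e * t ^+ 2.
  have := qle (u0 + t *: h) (rpredD u0U (rpredZ t hU)).
  by rewrite linearD linearZ /= !qE qeq /b /e => ?; nra.
suff : b = 0 by rewrite /b; lra.
apply/eqP; apply: contraT => b0.
(* For small [t] of sign opposite to [b] the linear term wins; this [t] works whatever the sign of
   [e], because [e <= n < 2 * (n + 1)]. *)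
have := quad (- b / (`|e| + 1)).
have := ler_norm e; set n := `|e|; have n0 : 0 <= n by exact: normr_ge0.
move=> en.
have -> : 2 * b * (- b / (n + 1)) + e * (- b / (n + 1)) ^+ 2 =
  (b / (n + 1)) ^+ 2 * (e - 2 * (n + 1)) by field; lra.
have : 0 < (b / (n + 1)) ^+ 2.
  by rewrite exprn_even_gt0 //= mulf_neq0 // invr_eq0; lra.
nra.
Qed.
End Extremal.

(** * The extended form: bilinearity, associativity, orthogonal complements *)

Section TraceForm.
Context {R : realType} {A : vectType R} {mul : {bilinear A -> A -> A}}.
Variable D : quadratic_decomposition mul.
Local Notation one := (qd_one D).
Local Notation sc := (qd_scal D).
Local Notation vec := (qd_vec D).
Local Notation ext := (qd_extform D).

Lemma qd_scal_is_scalar : scalar sc.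
Proof. by move=> a x y; rewrite /qd_scal linearP /= linearP. Qed.

Lemma qd_vec_is_linear : linear vec.
Proof. by move=> a x y; rewrite /qd_vec linearP /= linearP. Qed.

Lemma qd_extform_is_bilinear : bilinear_for *%R *%R ext.
Proof.
have fl := @linearPl _ _ _ _ _ _ (qd_form D).
have fr := @linearPr _ _ _ _ _ _ (qd_form D).
split=> z a x y; rewrite /qd_extform qd_scal_is_scalar qd_vec_is_linear /=.
  by rewrite fl /=; ring.
by rewrite fr /=; ring.
Qed.

HB.instance Definition _ := bilinear_isBilinear.Build R A A R *%R *%R ext
  qd_extform_is_bilinear.

Lemma qd_decomp z : z = sc z *: one + vsval (vec z).
Proof.
have : z \in (<[one]> + qd_W D)%VS by rewrite qd_full memvf.
case/memv_addP=> _ /vlineP[k ->] [w wW ->].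
by rewrite -[w]/(vsval (Subvs wW)) qd_scalE qd_vecE.
Qed.

Lemma qd_extformC x y : ext x y = ext y x.
Proof. by rewrite /qd_extform mulrC qd_form_sym. Qed.

Lemma qd_mul_decomp x y : mul x y =
  ext x y *: one +
  vsval (sc x *: vec y + sc y *: vec x + qd_wedge D (vec x) (vec y)).
Proof. by rewrite {1}(qd_decomp x) {1}(qd_decomp y) qd_mulE. Qed.

Lemma qd_scalM x y : sc (mul x y) = ext x y.
Proof. by rewrite qd_mul_decomp qd_scalE. Qed.

Lemma qd_vecM x y : vec (mul x y) =
  sc x *: vec y + sc y *: vec x + qd_wedge D (vec x) (vec y).
Proof. by rewrite qd_mul_decomp qd_vecE. Qed.

(** On [W] the form is the symmetric part of the product and the wedge its antisymmetric part. *)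
Lemma qd_mulC x y : sc x = 0 -> sc y = 0 ->
  mul x y = (2 * ext x y) *: one - mul y x.
Proof.
move=> x0 y0; rewrite !qd_mul_decomp x0 y0 !scale0r !add0r (qd_extformC y x).
rewrite [X in _ + vsval X]qd_wedge_anti linearN opprD addrA -scalerBl.
congr (_ *: _ - _).
by ring.
Qed.

Lemma qd_scal_one : sc one = 1.
Proof. by have := @qd_scalE _ _ _ D 1 0; rewrite scale1r linear0 addr0. Qed.

Lemma qd_vec_one : vec one = 0.
Proof. by have := @qd_vecE _ _ _ D 1 0; rewrite scale1r linear0 addr0. Qed.

Lemma qd_scal_vsval (w : subvs_of (qd_W D)) : sc (vsval w) = 0.
Proof. by have := @qd_scalE _ _ _ D 0 w; rewrite scale0r add0r. Qed.

Lemma qd_vec_vsval (w : subvs_of (qd_W D)) : vec (vsval w) = w.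
Proof. by have := @qd_vecE _ _ _ D 0 w; rewrite scale0r add0r. Qed.

Lemma qd_extform_one x : ext one x = sc x.
Proof. by rewrite /qd_extform qd_scal_one qd_vec_one mul1r linear0l addr0. Qed.

Lemma qd_mul1 x : mul one x = x.
Proof.
rewrite qd_mul_decomp qd_extform_one qd_scal_one qd_vec_one linear0l.
by rewrite scale1r scaler0 !addr0 -qd_decomp.
Qed.

Lemma qd_mulr1 x : mul x one = x.
Proof.
rewrite qd_mul_decomp qd_extformC qd_extform_one qd_scal_one qd_vec_one.
by rewrite linear0r scale1r scaler0 add0r !addr0 -qd_decomp.
Qed.

Lemma qd_sqr x : sc x = 0 -> mul x x = ext x x *: one.
Proof.
move=> x0; have := qd_mulC x x x0 x0 => /(congr1 (+%R (mul x x))).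
rewrite addrCA subrr addr0 -mulr2n -scaler_nat -scalerA.
by apply: scalerI; rewrite pnatr_eq0.
Qed.

Lemma qd_extform_lt0 x : sc x = 0 -> x != 0 -> ext x x < 0.
Proof.
move=> x0 xn0; rewrite /qd_extform x0 mul0r add0r qd_form_neg //.
by apply: contra xn0 => /eqP v0; rewrite (qd_decomp x) x0 v0 scale0r linear0 addr0.
Qed.

Hypothesis flexible : forall x y, associator mul x y x = 0.

(** The scalar part of [(xy)x = x(yx)] gives [(x/\y|x) = (x|y/\x)], which is also [-(x/\y|x)]. *)
Lemma qd_form_wedge_diag (x y : subvs_of (qd_W D)) : qd_form D (qd_wedge D x y) x = 0.
Proof.
have /(congr1 (ext one)) := flexible (vsval x) (vsval y).
rewrite linearBr linear0r /= !qd_extform_one !qd_scalM /qd_extform.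
rewrite !qd_vecM !qd_scal_vsval !qd_vec_vsval !scale0r !add0r mulr0 mul0r !add0r.
rewrite (qd_wedge_anti y x) linearNr /= qd_form_sym; lra.
Qed.

(** Polarization of the preceding identity, replacing [x] by [x + z]. *)
Lemma qd_form_wedgeA (x y z : subvs_of (qd_W D)) :
  qd_form D (qd_wedge D x y) z = qd_form D x (qd_wedge D y z).
Proof.
have := qd_form_wedge_diag (x + z) y.
rewrite !linearDl !linearDr /= !qd_form_wedge_diag (qd_form_sym x).
by rewrite (qd_wedge_anti y z) linearNl /=; lra.
Qed.

Lemma qd_extformA x y z : ext (mul x y) z = ext x (mul y z).
Proof.
rewrite /qd_extform !qd_scalM !qd_vecM /qd_extform !linearDl !linearDr /=.
have fZl a (v w : subvs_of (qd_W D)) :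
  qd_form D (a *: v) w = a * qd_form D v w by rewrite linearZl_LR.
have fZr a (v w : subvs_of (qd_W D)) :
  qd_form D v (a *: w) = a * qd_form D v w by rewrite linearZr_LR.
by rewrite qd_form_wedgeA !fZl !fZr; ring.
Qed.

Lemma mem_qd_W z : (z \in qd_W D) = (sc z == 0).
Proof.
apply/idP/eqP => [zW|z0].
  by rewrite -[z]/(vsval (Subvs zW)) qd_scal_vsval.
by rewrite (qd_decomp z) z0 scale0r add0r; exact: subvsP.
Qed.

(** Every [b] is quadratic: with [w] its component in [W], [b^2 - 2 sc(b) b = ((w|w) - sc(b)^2) 1].
    The scalar on the right is negative if [w] is nonzero; otherwise [b] is itself a multiple of
    1. *)
Lemma one_in_subalgebra (B : {vspace A}) b :
  is_subalgebra mul B -> b \in B -> b != 0 -> one \in B.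
Proof.
move=> hB bB bn0; pose w := b - sc b *: one.
have scw : sc w = 0.
  rewrite -qd_extform_one linearBr linearZr_LR /= !qd_extform_one.
  by rewrite qd_scal_one mulr1 subrr.
have key : (ext w w - sc b ^+ 2) *: one = mul b b - (2 * sc b) *: b.
  have bE : b = sc b *: one + w by rewrite addrC subrK.
  have -> : mul b b = sc b *: b + (sc b *: w + ext w w *: one).
    rewrite {1}bE linearDl linearZl_LR /= qd_mul1; congr (_ + _).
    by rewrite {1}bE linearDr linearZr_LR /= qd_mulr1 qd_sqr.
  rewrite scalerBl mulr_natl mulr2n (scalerDl b (sc b)) opprD addrACA subrr add0r.
  have -> : sc b *: w = sc b *: b - sc b ^+ 2 *: one.
    by rewrite scalerBr scalerA expr2.
  by rewrite addrC addrA addKr addrC.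
have [w0|wn0] := eqVneq w 0.
  have bE : b = sc b *: one by apply/eqP; rewrite -subr_eq0 -/w w0.
  have sb : sc b != 0 by apply: contra bn0 => /eqP s0; rewrite bE s0 scale0r.
  have -> : one = (sc b)^-1 *: b by rewrite {2}bE scalerA mulVf ?scale1r.
  exact: rpredZ.
have kn0 : ext w w - sc b ^+ 2 != 0.
  rewrite lt_eqF //; have := qd_extform_lt0 w scw wn0; have := sqr_ge0 (sc b); lra.
have -> : one = (ext w w - sc b ^+ 2)^-1 *: (mul b b - (2 * sc b) *: b).
  by rewrite -key scalerA mulVf ?scale1r.
by rewrite rpredZ ?rpredB ?rpredZ ?hB.
Qed.

(** The orthogonal is the kernel of pairing with a basis of [B], and rank-nullity bounds its
    dimension below. *)
Lemma orth_vspace (B : {vspace A}) :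
  exists C : {vspace A}, (forall z, z \in C <-> in_orth D B z) /\
    (\dim {:A} <= \dim B + \dim C)%N.
Proof.
pose f z : 'rV[R]_(\dim B) := \row_i ext z (vbasis B)`_i.
have f_lin : linear f.
  move=> a x y; apply/rowP => i; rewrite !mxE.
  by rewrite linearDl linearZl_LR.
pose F : {linear A -> 'rV[R]_(\dim B)} :=
  HB.pack f (GRing.isLinear.Build _ _ _ _ f f_lin).
exists (lker (linfun F)); split=> [z|].
  rewrite memv_ker lfunE /=; split=> [/eqP/rowP fz b bB|zB].
    rewrite (coord_vbasis bB) linear_sumr big1 // => i _.
    by have := fz i; rewrite !mxE linearZr_LR /= => ->; rewrite mulr0.
  apply/eqP/rowP => i; rewrite !mxE; apply: zB; apply: vbasis_mem.
  by apply: mem_nth; rewrite size_tuple.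
rewrite -(limg_ker_dim (linfun F) fullv) capfv addnC leq_add2r.
by apply: leq_trans (dimvS (subvf _)) _; rewrite dimvf /dim /= mul1n.
Qed.
End TraceForm.

(** * Four-dimensional subalgebras from orthogonal vectors *)

Section Generation.
Context {R : realType} {A : vectType R}.

(** A vector in the span of the later ones would be orthogonal to itself. *)
Lemma orthogonal_free (q : {biscalar A}) (X : seq A) :
  all (fun x => q x x != 0) X -> pairwise (fun x y => q x y == 0) X -> free X.
Proof.
elim: X => [|x X IH] /=; first by rewrite nil_free.
case/andP=> xn0 Xn0 /andP[/allP xX pX]; rewrite free_cons IH // andbT.
apply: contra xn0 => /(@coord_span _ _ _ (in_tuple X)) xE.
rewrite {2}xE linear_sumr big1 // => i _.
by rewrite linearZr_LR /= (eqP (xX _ (mem_nth _ _))) ?mulr0.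
Qed.

Lemma span_is_subalgebra (mul : {bilinear A -> A -> A}) (X : seq A) :
  {in X &, forall x y, mul x y \in <<X>>%VS} -> is_subalgebra mul <<X>>%VS.
Proof.
have spanE := @coord_span _ _ _ (in_tuple X).
move=> hX x y /spanE -> /spanE ->.
rewrite linear_sumlz; apply: rpred_sum => i _.
rewrite linear_sumr; apply: rpred_sum => j _.
by rewrite linearZl_LR linearZr_LR /= !rpredZ // hX ?mem_nth.
Qed.

(** With [y = ux], the vectors 1, u, x, y are pairwise orthogonal, hence independent, and their span
    is closed under products. Any subalgebra containing [u] and [x] contains 1 and [ux]. *)
Lemma generates_dim4 {mul : {bilinear A -> A -> A}}
    (D : quadratic_decomposition mul) {u x : A} {a b : R} :
  (forall x y, associator mul x y x = 0) ->
  qd_scal D u = 0 -> qd_scal D x = 0 -> qd_extform D u x = 0 ->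
  u != 0 -> x != 0 -> mul u x != 0 ->
  mul (mul u x) x = a *: u -> mul u (mul u x) = b *: x ->
  exists S : {vspace A},
    generates_subalgebra mul (fun z => z = u \/ z = x) S /\ \dim S = 4%N.
Proof.
move=> flex u0 x0 ux0 un0 xn0; move yE : (mul u x) => y yn0 yx uy.
have y0 : qd_scal D y = 0 by rewrite -yE qd_scalM.
(* [(u|ux) = (uu|x) = (u|u)(1|x) = 0]; the next orthogonality is dual. *)
have uy0 : qd_extform D u y = 0.
  by rewrite -yE -qd_extformA // (qd_sqr D) // linearZl_LR /= qd_extform_one x0 mulr0.
have xy0 : qd_extform D x y = 0.
  rewrite qd_extformC -yE qd_extformA // (qd_sqr D) // linearZr_LR /=.
  by rewrite qd_extformC qd_extform_one u0 mulr0.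
have yx0 : qd_extform D y x = 0 by rewrite qd_extformC.
have anti v w : qd_scal D v = 0 -> qd_scal D w = 0 -> qd_extform D v w = 0 ->
    mul w v = - mul v w.
  by move=> v0 w0 vw; rewrite (qd_mulC D) // qd_extformC vw mulr0 scale0r sub0r.
pose X := [:: qd_one D; u; x; y].
exists <<X>>%VS; split; last first.
  (* [free X] unfolds to the equality of the dimension of the span with the length 4 of [X]. *)
  apply/eqP; change (free X); apply: (orthogonal_free (qd_extform D)) => /=.
    by rewrite qd_extform_one qd_scal_one oner_eq0 !lt_eqF ?qd_extform_lt0.
  by rewrite !qd_extform_one u0 x0 y0 ux0 uy0 xy0 !eqxx.
have inX v : v \in X -> v \in <<X>>%VS by exact: memv_span.
have oneX : qd_one D \in <<X>>%VS by rewrite inX ?inE ?eqxx.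
have uX : u \in <<X>>%VS by rewrite inX ?inE ?eqxx ?orbT.
have xX : x \in <<X>>%VS by rewrite inX ?inE ?eqxx ?orbT.
have yX : y \in <<X>>%VS by rewrite inX ?inE ?eqxx ?orbT.
split.
- apply: span_is_subalgebra => v w; rewrite !inE.
  (* Beyond products with 1, three are squares, three are [ux], [yx], [uy], and three follow by
     anticommutation. *)
  move=> /or4P[] /eqP -> /or4P[] /eqP ->; rewrite ?(qd_mul1 D) ?(qd_mulr1 D) //;
  rewrite ?yE ?yx ?uy ?(qd_sqr D) ?(anti u x) ?(anti u y) ?(anti y x) ?yE ?uy ?yx
    ?rpredN ?rpredZ //.
- by move=> z [->|->].
- move=> T hT XT.
  have uT := XT u (or_introl erefl); have xT := XT x (or_intror erefl).
  apply/span_subvP => v; rewrite !inE => /or4P[] /eqP -> //.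
    exact: one_in_subalgebra uT un0.
  by rewrite -yE hT.
Qed.
End Generation.

(** * The maximizing pair and the subalgebra it generates *)

Theorem proposition3p14 (R : realType) (A : vectType R)
  (mul : {bilinear A -> A -> A})
  (hNJ : noncommutative_jordan mul)
  (hdiv : linear_division mul)
  (D : quadratic_decomposition mul)
  (hdimA : \dim (fullv : {vspace A}) = 8%N)
  (B : {vspace A})
  (hB : is_subalgebra mul B)
  (hdimB : \dim B = 4%N)
  (hBB : forall x y : A, in_orth D B x -> in_orth D B y -> mul x y \in B) :
  exists u0 x0 : A,
    [/\ u0 \in B, in_orth D B x0
      & exists S : {vspace A},
          generates_subalgebra mul (fun z => z = u0 \/ z = x0) S /\
          \dim S = 4%N].
Proof.
have [flex _] := hNJ.
pose ext : {biscalar A} := qd_extform D.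
have extC x y : ext x y = ext y x by exact: qd_extformC.
have extA x y z : ext (mul x y) z = ext x (mul y z) by exact: qd_extformA.
have ext_eq0 z : qd_scal D z = 0 -> ext z z = 0 -> z = 0.
  move=> z0 ezz; apply/eqP/contraT => zn0.
  by have := qd_extform_lt0 D z z0 zn0; rewrite [X in X < _]ezz ltxx.
have [b bB bn0] : exists2 b, b \in B & b != 0.
  by exists (vpick B); rewrite ?memv_pick // vpick0 -dimv_eq0 hdimB.
have oneB : qd_one D \in B by exact: one_in_subalgebra bB bn0.
have [C [CP dimC]] := orth_vspace D B.
pose V := (B :&: qd_W D)%VS.
have VP z : (z \in V) = (z \in B) && (qd_scal D z == 0) by rewrite memv_cap mem_qd_W.
(* Otherwise each element of [B] equals its scalar part, forcing dimension at most 1. *)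
have Vn0 : V != 0%VS.
  apply/eqP => V0; suff : (B <= <[qd_one D]>)%VS.
    by move/dimvS; rewrite hdimB dim_vline; case: (_ != _).
  apply/subvP => z zB.
  have : z - qd_scal D z *: qd_one D \in V.
    rewrite VP rpredB ?rpredZ //= -qd_extform_one linearBr linearZr_LR /=.
    by rewrite !qd_extform_one qd_scal_one mulr1 subrr.
  by rewrite V0 memv0 subr_eq0 => /eqP ->; rewrite rpredZ ?memv_line.
have Cn0 : C != 0%VS.
  by rewrite -dimv_eq0; apply: contraTneq dimC => ->; rewrite hdimA hdimB.
have Vsc u : u \in V -> qd_scal D u = 0 by rewrite VP => /andP[_ /eqP].
have VB u : u \in V -> u \in B by rewrite VP => /andP[].
(* Since 1 lies in [B], its orthogonal [C] lies in [W]. *)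
have Csc x : x \in C -> qd_scal D x = 0.
  by move=> /CP xC; rewrite -qd_extform_one qd_extformC xC.
have orth u x : u \in B -> x \in C -> ext u x = 0.
  by move=> uB /CP xC; rewrite extC; exact: xC.
(* For [v] in [B], [(v|ux) = (vu|x) = 0] because [vu] lies in [B]. *)
have BC u x : u \in B -> x \in C -> mul u x \in C.
  move=> uB xC; apply/CP => v vB.
  by rewrite -[LHS]/(ext _ _) extC -extA orth ?hB.
have anti u x : u \in V -> x \in C -> mul x u = - mul u x.
  move=> uV xC; rewrite (qd_mulC D x u (Csc x xC) (Vsc u uV)).
  by rewrite -[qd_extform D x u]/(ext x u) extC orth ?VB // mulr0 scale0r sub0r.
have ltV u : u \in V -> u != 0 -> ext u u < 0.
  by move=> /Vsc; exact: qd_extform_lt0.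
have ltC x : x \in C -> x != 0 -> ext x x < 0.
  by move=> /Csc; exact: qd_extform_lt0.
have [||u [x [uV un0 xC xn0 rho_max]]] :=
  bilinear_ratio_max ext mul V C Vn0 Cn0.
- by move=> u uV un0; rewrite lt_eqF ?ltV.
- by move=> x xC xn0; rewrite lt_eqF ?ltC.
set c := ext (mul u x) (mul u x) / _ in rho_max.
have cE : ext (mul u x) (mul u x) = c * (ext u u * ext x x).
  rewrite /c divfK //; apply: mulf_neq0.
    by rewrite lt_eqF // ltV.
  by rewrite lt_eqF // ltC.
have ext00 : ext 0 0 = 0 by rewrite linear0r.
(* Clearing the denominator keeps the inequality: it is a product of two negative numbers. Zero
   vectors are treated apart. *)
have c_max v z : v \in V -> z \in C ->
    ext (mul v z) (mul v z) <= c * (ext v v * ext z z).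
  move=> vV zC; have [->|vn0] := eqVneq v 0.
    by rewrite linear0l ext00 mul0r mulr0.
  have [->|zn0] := eqVneq z 0.
    by rewrite linear0r ext00 !mulr0.
  rewrite -ler_pdivrMr; first exact: rho_max.
  by rewrite (nmulr_lgt0 _ (ltC z zC zn0)) ltV.
(* Criticality in the first variable, for right multiplication by [x] on [V]; [critC] is its
   analogue for left multiplication by [u] on [C]. *)
have critV h : h \in V -> ext (mul u x) (mul h x) = c * ext x x * ext u h.
  apply: (critical_point_linear ext (applyr mul x) V) => //= [v vV|].
    by rewrite -mulrA (mulrC (ext x x)) c_max.
  by rewrite cE -mulrA (mulrC (ext x x)).
have critC k : k \in C -> ext (mul u x) (mul u k) = c * ext u u * ext x k.
  apply: (critical_point_linear ext (mul u) C) => //= [z zC|].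
    by rewrite -mulrA c_max.
  by rewrite cE -mulrA.
have uxC : mul u x \in C by rewrite BC ?VB.
(* The defect in [(ux)x = -c(x|x)u]. It lies in [B] by the hypothesis on products of orthogonal
   elements, and its scalar part is [(ux|x) = (u|xx) = 0]. *)
pose e := mul (mul u x) x + (c * ext x x) *: u.
have eV : e \in V.
  rewrite rpredD ?rpredZ // VP hBB /=; [|exact/CP|exact/CP].
  rewrite qd_scalM -[_ D _ _]/(ext _ _) extA (qd_sqr D) ?Csc // linearZr_LR /=.
  by rewrite (qd_extformC D u) qd_extform_one Vsc // mulr0.
have e0 : e = 0.
  apply: ext_eq0; first exact: Vsc.
  (* [((ux)x|e) = (ux|xe) = -(ux|ex)], so criticality in the direction [e] gives [(e|e) = 0]. *)
  rewrite {1}/e linearDl linearZl_LR /= extA (anti e x eV xC).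
  by rewrite linearNr /= critV // addNr.
(* The defect in [u(ux) = -c(u|u)x], killed likewise by criticality in the direction [g]. *)
pose g := mul u (mul u x) + (c * ext u u) *: x.
have gC : g \in C by rewrite rpredD ?rpredZ ?BC ?VB.
have g0 : g = 0.
  apply: ext_eq0; first exact: Csc.
  rewrite {1}/g linearDl linearZl_LR /= (extC (mul u _)) -extA.
  by rewrite (anti u g uV gC) linearNl /= (extC (mul u g)) critC // addNr.
exists u, x; split; [exact: VB | exact/CP |].
apply: (generates_dim4 D (a := - (c * ext x x)) (b := - (c * ext u u))) => //;
  do ?[exact: Vsc | exact: Csc].
- exact: orth (VB _ uV) xC.
(* Left multiplication by [u] is injective in a division algebra, so [ux] is nonzero. *)
- have [[f fK _] _] := hdiv.2 u un0.
  apply: contra xn0 => /eqP ux0; apply/eqP/(can_inj fK).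
  by rewrite ux0 linear0r.
- by apply/eqP; rewrite scaleNr -addr_eq0; apply/eqP.
- by apply/eqP; rewrite scaleNr -addr_eq0; apply/eqP.
Qed.
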